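(* Let $d\geq 1$ and $m\geq 2$ be integers. (a) Let $r\geq 3$ and $k\geq 0$ be integers, and let $n=(r-1)(d+m+1)+k+1$. If $\ell$ is an integer with $\ell>2+\frac{k+2}{r-2}$, then there exists a set $X$ of $n+\ell$ affinely spanning points in $\mathbb{R}^{n-d-1}$ and an $m$-coloring of $X$ which cannot be equidistributed by any conical $r$-fan in $\mathbb{R}^{n-d-1}$. (b) Let $k\geq 0$ be an integer and let $n=2(d+1)+m+k$. If $\ell$ is an integer with $\ell>k+3$, then there exists a set $X$ of $n+\ell$ complex affinely spanning points in $\mathbb{C}^{n-d-1}$ and an $m$-coloring of $X$ which cannot be equidistributed by any complex regular $2$-fan in $\mathbb{C}^{n-d-1}$.
   Context: A set of points in $\mathbb{R}^D$ (resp. $\mathbb{C}^D$) is affinely spanning (resp. complex affinely spanning) if it is not contained in a real (resp. complex) affine hyperplane. An $m$-coloring of a finite set $X$ is a partition $X=X_1\sqcup\cdots\sqcup X_m$ into $m$ non-empty subsets. Fans. A $k'$-flat is a $k'$-dimensional affine subspace of $\mathbb{R}^D$ ($1\le k'\le D-1$). If $A$ is a $k'$-flat and $H$ is an affine hyperplane which intersects but does not contain $A$, then $B=A\cap H^+$, with $H^+$ a closed half-space of $H$, is a (closed) half $k'$-flat; its boundary is $\partial B=A\cap H$. An $r$-fan is a union $F_r=\bigcup_{j=1}^r B_j$ of $r$ half $k'$-flats which all have the same boundary $C$, a $(k'-1)$-flat called the center. Write $\mathrm{Int}(B_j)=B_j\setminus C$. An $r$-fan equidistributes an $m$-coloring $X=X_1\sqcup\cdots\sqcup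 X_m$ if $X\subseteq F_r$ and $|\mathrm{Int}(B_j)\cap X_i|\leq |X_i|/r$ for all $1\le j\le r$ and $1\le i\le m$. Conical fans. Let $H_1,\ldots,H_r$ be oriented affine hyperplanes in $\mathbb{R}^D$ (each with a designated closed half-space $H_j^+$) such that (1) the normal vectors of any $r-1$ of them are linearly independent, and (2) the normal vectors of all $r$ of them are linearly dependent and $\bigcap_{i=1}^r H_i\neq\emptyset$. With indices taken cyclically mod $r$, let $A_j=\bigcap_{i\neq j-1,j}H_i$ and $B_j=H_j^+\cap A_j$. Then $F_r=\bigcup_{j=1}^r B_j$ is an $r$-fan of codimension $r-2$ with center $\bigcap_{i=1}^r H_i$; such an $r$-fan is called conical. Complex regular $2$-fans. A complex regular $2$-fan in $\mathbb{C}^D\cong\mathbb{R}^{2D}$ is a real affine hyperplane written as the union $B_1\cup B_2$ of two closed half-hyperplanes whose common boundary (the center) is a complex affine hyperplane. Equivalently, with $\langle u,w\rangle=\sum_i u_i\overline{w_i}$, there are $\alpha\in\mathbb{C}^D\setminus\{0\}$, $\beta\in\mathbb{C}$ with $B_j=\{z\in\mathbb{C}^D\mid \langle\alpha,z\rangle=\beta+t(-1)^j\text{ for some real }t\geq 0\}$ for $j=1,2$. *)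

(* Defs.v *)
From mathcomp Require Import all_boot all_order all_algebra.
From mathcomp Require Import finmap boolp classical_sets reals.
From mathcomp Require Export complex.
From mathcomp Require Import lra.

Set Implicit Arguments.
Unset Strict Implicit.
Unset Printing Implicit Defensive.

Import Order.TTheory GRing.Theory Num.Theory.

Local Open Scope classical_set_scope.
Local Open Scope ring_scope.

(* Affine hyperplanes over a field: real ones for F = R and complex ones for
   F = R[i]; hyperplane a b is a genuine hyperplane when a != 0. *)
Definition hyperplane (F : fieldType) (D : nat) (a : 'rV[F]_D) (b : F)
    : set 'rV[F]_D :=
  [set x | \sum_(i < D) a 0 i * x 0 i = b].

Definition affinely_spanning (F : fieldType) (D : nat) (X : {fset 'rV[F]_D})
    : Prop :=
  forall (a : 'rV[F]_D) (b : F), a != 0 -> ~ ([set` X] `<=` hyperplane a b).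

Definition is_coloring (T : choiceType) (m : nat) (X : {fset T})
    (c : 'I_m -> {fset T}) : Prop :=
  [/\ forall i, c i != fset0,
      forall i j, i != j -> [disjoint c i & c j]%fset &
      forall x, (x \in X) = [exists i, x \in c i]].

(* A fan is given by its half-flats B j together with their common boundary C,
   so that Int (B j) = B j `\` C. *)
Definition equidistributes (T : choiceType) (r m : nat)
    (B : 'I_r -> set T) (C : set T) (X : {fset T}) (c : 'I_m -> {fset T})
    : Prop :=
  [set` X] `<=` \bigcup_j B j /\
  forall (j : 'I_r) (i : 'I_m),
    #|` [fset x in c i | x \in (B j `\` C)%classic]%fset|%:R <= #|` c i|%:R / r%:R :> rat.

Section RealFans.
Variables (R : realType) (D : nat).

Definition halfspace (a : 'rV[R]_D) (b : R) : set 'rV[R]_D :=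
  [set x | b <= \sum_(i < D) a 0 i * x 0 i].

(* Row j of N is the normal vector of the hyperplane H_j, pointing into the
   designated half-space H_j^+; ord_pred is the cyclic predecessor. *)
Definition conical_fan (r : nat) (B : 'I_r -> set 'rV[R]_D)
    (C : set 'rV[R]_D) : Prop :=
  exists (N : 'M[R]_(r, D)) (b : 'I_r -> R),
    let H i := hyperplane (row i N) (b i) in
    let A j := \bigcap_(i in [set i | i != ord_pred j /\ i != j]) H i in
    (forall j, row j N != 0) /\
    [/\ forall j, row_free (row' j N),
        ~~ row_free N,
        \bigcap_i H i !=set0,
        forall j, B j = halfspace (row j N) (b j) `&` A j &
        C = \bigcap_i H i].

End RealFans.

Section ComplexFans.
Variables (R : realType) (D : nat).
Implicit Types (u w z h : 'rV[R[i]]_D) (A B C : set 'rV[R[i]]_D).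

Definition hdot u w : R[i] := \sum_(i < D) u 0 i * (w 0 i)^*%C.

(* Under C^D = R^(2D) the Euclidean inner product is Re (hdot _ _), whence
   the real hyperplanes and half-spaces of C^D. *)
Definition real_hyperplane h (s : R) : set 'rV[R[i]]_D :=
  [set z | complex.Re (hdot h z) = s].

Definition real_halfspace h (s : R) : set 'rV[R[i]]_D :=
  [set z | s <= complex.Re (hdot h z)].

Definition half_flat A B C : Prop :=
  exists h s,
    [/\ h != 0, A `&` real_hyperplane h s !=set0,
        ~ (A `<=` real_hyperplane h s),
        B = A `&` real_halfspace h s & C = A `&` real_hyperplane h s].

Definition complex_regular_2fan (B : 'I_2 -> set 'rV[R[i]]_D) C : Prop :=
  exists a s,
    [/\ a != 0,
        forall j, half_flat (real_hyperplane a s) (B j) C,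
        real_hyperplane a s = \bigcup_j B j &
        exists g b, g != 0 /\ C = hyperplane g b].

End ComplexFans.

Section ComplexFanFormula.
Variables (R : realType) (D : nat).
Implicit Types (u w z h : 'rV[R[i]]_D) (a b : R[i]).

Lemma hdotDr u w z : hdot u (w + z) = hdot u w + hdot u z.
Proof.
rewrite /hdot -big_split /=; apply: eq_bigr => i _.
by rewrite mxE rmorphD mulrDr.
Qed.

Lemma hdotZr a u w : hdot u (a *: w) = a^*%C * hdot u w.
Proof.
rewrite /hdot mulr_sumr; apply: eq_bigr => i _.
by rewrite mxE rmorphM mulrCA.
Qed.

Lemma hdotZl a u w : hdot (a *: u) w = a * hdot u w.
Proof. by rewrite /hdot mulr_sumr; apply: eq_bigr => i _; rewrite mxE mulrA. Qed.

Lemma hdot_surj u b : u != 0 -> exists z, hdot u z = b.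
Proof.
move=> /rV0Pn [i ui0]; exists ((b / u 0 i)^*%C *: delta_mx 0 i).
rewrite hdotZr conjcK /hdot (bigD1 i) //= big1 => [|j ji]; last first.
  by rewrite mxE (negbTE ji) andbF conjc0 mulr0.
by rewrite mxE !eqxx conjc1 mulr1 addr0 divfK.
Qed.

Lemma hyperplane_hdot u b :
  hyperplane (map_mx (@conjc R) u) b^*%C = [set z | hdot u z = b].
Proof.
have E z : \sum_i map_mx (@conjc R) u 0 i * z 0 i = (hdot u z)^*%C.
  by rewrite rmorph_sum; apply: eq_bigr => i _; rewrite mxE rmorphM /= conjcK.
apply/seteqP; split => z; rewrite /hyperplane /= E; last by move=> ->.
exact: (can_inj (@conjcK R)).
Qed.

Lemma hdot_factor (u h : 'rV[R[i]]_D) (b : R[i]) (s : R) : u != 0 ->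
  (forall z, hdot u z = b -> complex.Re (hdot h z) = s) ->
  exists c, (forall z, hdot h z = c * hdot u z) /\ s = complex.Re (c * b).
Proof.
move=> u0 hs; have [w w1] := hdot_surj 1 u0; exists (hdot h w).
have kerR z : hdot u z = 0 -> complex.Re (hdot h z) = 0.
  move=> z0; have pb : hdot u (b^*%C *: w) = b by rewrite hdotZr conjcK w1 mulr1.
  have := hs (b^*%C *: w + z); rewrite hdotDr pb z0 addr0 => /(_ erefl).
  rewrite hdotDr raddfD /= (hs _ pb) => e.
  by apply: (addrI s); rewrite e addr0.
have ker z : hdot u z = 0 -> hdot h z = 0.
  move=> z0; have := kerR ('i%C *: z); rewrite !hdotZr z0 mulr0 => /(_ erefl).
  move: (kerR z z0); case: (hdot h z) => x y /= ->.
  by rewrite mulr0 sub0r mulN1r opprK => ->.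
have fac z : hdot h z = hdot h w * hdot u z.
  have := ker (z + (- hdot u z)^*%C *: w).
  rewrite !hdotDr !hdotZr conjcK w1 mulr1 subrr => /(_ erefl).
  by rewrite mulNr => /eqP; rewrite subr_eq0 mulrC => /eqP.
split=> //; have [p pb] := hdot_surj b u0.
by rewrite -(hs p pb) fac pb.
Qed.

(* Parametric form; the half-hyperplanes B_1 and B_2 are B ord0 and B ord_max,
   hence the exponent j.+1. *)
Lemma complex_regular_2fanP (B : 'I_2 -> set 'rV[R[i]]_D)
    (C : set 'rV[R[i]]_D) :
  complex_regular_2fan B C <->
  exists (u : 'rV[R[i]]_D) (b : R[i]),
    [/\ u != 0,
        forall j : 'I_2, B j =
          [set z | exists2 t : R,
             0 <= t & hdot u z = b + (t * (-1) ^+ j.+1)%:C%C] &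
        C = [set z | hdot u z = b]].
Proof.
split; last first.
  move=> [u [b [u0 BE CE]]].
  have nz0 a : a != 0 -> a *: u != 0 by move=> a0; rewrite scaler_eq0 negb_or a0.
  have i0 : 'i%C != 0 :> R[i] by rewrite eq_complex /= oner_eq0 andbF.
  have inA z : real_hyperplane ('i%C *: u) (complex.Re ('i%C * b)) z <->
      complex.Im (hdot u z) = complex.Im b.
    rewrite /real_hyperplane /= hdotZl; case: (hdot u z) b {BE CE} => [x y] [p q].
    by rewrite /= !mul0r !sub0r !mul1r; split=> [/oppr_inj|->].
  exists ('i%C *: u), (complex.Re ('i%C * b)); split.
  - exact: nz0.
  - move=> j; set e : R := (-1) ^+ j.+1.
    have e2 : e * e = 1 by rewrite -expr2 sqrr_sign.
    have e0 : e != 0 by rewrite signr_eq0.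
    have hE z : complex.Re (hdot (e%:C%C *: u) z) = e * complex.Re (hdot u z).
      by rewrite hdotZl; case: (hdot u z) => x y /=; rewrite mul0r subr0.
    exists (e%:C%C *: u), (e * complex.Re b); split.
    + by apply: nz0; rewrite eq_complex /= negb_and e0.
    + have [z zb] := hdot_surj b u0; exists z; split; first by apply/inA; rewrite zb.
      by rewrite /real_hyperplane /= hE zb.
    + move=> sub; have [z zb] := hdot_surj (b + 1) u0.
      have /sub : real_hyperplane ('i%C *: u) (complex.Re ('i%C * b)) z.
        by apply/inA; rewrite zb raddfD /= addr0.
      rewrite /real_hyperplane /= hE zb raddfD /= mulrDr mulr1 => /eqP.
      by rewrite -subr_eq0 addrAC subrr add0r (negbTE e0).
    + rewrite BE; apply/seteqP; split=> z /=.
        move=> [t t0 zE]; split; first by apply/inA; rewrite zE raddfD /= addr0.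
        rewrite /real_halfspace /= hE zE raddfD /= mulrDr -/e mulrCA e2 mulr1.
        by rewrite lerDl.
      move=> [/inA zI]; rewrite /real_halfspace /= hE => le.
      exists (e * (complex.Re (hdot u z) - complex.Re b)).
        by rewrite mulrBr subr_ge0.
      rewrite -/e mulrAC e2 mul1r; case: (hdot u z) b zI {BE CE inA le} => [x y] [p q] /= ->.
      by simpc; rewrite addrC subrK.
    + rewrite CE; apply/seteqP; split=> z /=.
        move=> zE; split; first by apply/inA; rewrite zE.
        by rewrite /real_hyperplane /= hE zE.
      move=> [/inA zI]; rewrite /real_hyperplane /= hE => /(mulfI e0) zR.
      by apply/eqP; rewrite eq_complex zR zI !eqxx.
  - apply/seteqP; split=> z.
      move=> /inA zI; set x := complex.Re (hdot u z) - complex.Re b.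
      have zE : hdot u z = b + x%:C%C.
        rewrite /x; case: (hdot u z) b zI {BE CE inA x} => [x y] [p q] /= ->.
        by simpc; rewrite addrC subrK.
      have [x0|x0] := leP 0 x.
        by exists ord_max => //; rewrite BE; exists x; rewrite // sqrrN expr1n mulr1.
      exists ord0 => //; rewrite BE; exists (- x); first by rewrite oppr_ge0 ltW.
      by rewrite expr1 mulrN1 opprK.
    move=> [j _]; rewrite BE => -[t t0 zE]; apply/inA.
    by rewrite zE raddfD /= addr0.
  - exists (map_mx (@conjc R) u), b^*%C; split; last by rewrite hyperplane_hdot.
    by rewrite map_mx_eq0.
move=> [a [s [a0 hf AE [g [b0 [g0 CE]]]]]].
pose v := map_mx (@conjc R) g; pose b1 := b0^*%C.
have v0 : v != 0 by rewrite map_mx_eq0.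
have {}CE : C = [set z | hdot v z = b1].
  rewrite CE -hyperplane_hdot /b1 conjcK; congr hyperplane.
  by apply/matrixP=> i j; rewrite !mxE conjcK.
have [p pb] := hdot_surj b1 v0.
have nz h c : h != 0 -> (forall z, hdot h z = c * hdot v z) -> c != 0.
  move=> h0 hc; apply/eqP => c0; have [z] := hdot_surj 1 h0.
  by rewrite hc c0 mul0r => /eqP; rewrite eq_sym oner_eq0.
have [c [ac sc]] : exists c, (forall z, hdot a z = c * hdot v z) /\
    s = complex.Re (c * b1).
  apply: hdot_factor => // z zb; have [h [t [_ _ _ _ CA]]] := hf ord0.
  by have : C z by [rewrite CE]; rewrite CA => -[].
have c0 := nz _ _ a0 ac.
pose al := - 'i%C * c.
have al0 : al != 0 by rewrite mulf_neq0 // eq_complex /= oppr0 oppr_eq0 oner_eq0 andbF.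
have cal : c = 'i%C * al by rewrite /al mulrA mulrN -expr2 sqr_i opprK mul1r.
pose U z : R[i] := al * (hdot v z - b1).
have Usurj x : exists z, U z = x.
  have [z zE] := hdot_surj (x / al + b1) v0; exists z.
  by rewrite /U zE addrK mulrC divfK.
have CU : C = [set z | U z = 0].
  rewrite CE; apply/seteqP; split=> z /=; rewrite /U; first by move=> ->; rewrite subrr mulr0.
  by move=> /eqP; rewrite mulf_eq0 (negbTE al0) subr_eq0 => /eqP.
have inA z : real_hyperplane a s z <-> complex.Im (U z) = 0.
  have -> : complex.Im (U z) = s - complex.Re (hdot a z).
    rewrite ac sc -raddfB -mulrBr cal -mulrA -[b1 - _]opprB mulrN -/(U z).
    by case: (U z) => x y /=; rewrite mul0r mul1r sub0r opprK.
  by rewrite /real_hyperplane /=; split=> [->|/eqP]; rewrite ?subrr// subr_eq0 => /eqP.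
have /choice[k kP] : forall j, exists k : R,
    k != 0 /\ B j = [set z | complex.Im (U z) = 0 /\ 0 <= k * complex.Re (U z)].
  move=> j; have [h [t [h0 _ _ BA CA]]] := hf j.
  have [cj [hc tc]] : exists c, (forall z, hdot h z = c * hdot v z) /\
      t = complex.Re (c * b1).
    by apply: hdot_factor => // z zb; have : C z by [rewrite CE]; rewrite CA => -[].
  pose k := complex.Re (cj / al); exists k.
  have hE z : complex.Im (U z) = 0 -> complex.Re (hdot h z) - t = k * complex.Re (U z).
    rewrite hc tc -raddfB -mulrBr.
    have -> : cj * (hdot v z - b1) = cj / al * U z by rewrite /U mulrA divfK.
    by rewrite /k; case: (cj / al) (U z) => [x y] [x' y'] /= ->; rewrite mulr0 subr0.
  split.
    apply/eqP => k0; have [z zE] := Usurj 1.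
    have zI : complex.Im (U z) = 0 by rewrite zE.
    have : C z.
      rewrite CA; split; first by apply/inA.
      by apply/eqP; rewrite -subr_eq0 hE // k0 mul0r.
    by rewrite CU /= zE => /eqP; rewrite oner_eq0.
  rewrite BA; apply/seteqP; split=> z [].
    by move=> /inA zI; rewrite /real_halfspace /= -subr_ge0 hE.
  by move=> zI; rewrite -hE // subr_ge0 => ?; split=> //; apply/inA.
have cover (x : R) : exists j, 0 <= k j * x.
  have [z zE] := Usurj x%:C%C.
  have : real_hyperplane a s z by apply/inA; rewrite zE.
  rewrite AE => -[j _]; have [_ ->] := kP j => -[_].
  by rewrite zE /= => ?; exists j.
pose e : R := Num.sg (k ord_max).
have k1 := (kP ord_max).1; have kk0 := (kP ord0).1.
have e2 : e * e = 1 by rewrite -expr2 sqr_sg k1.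
have e0 : e != 0 by rewrite sgr_eq0.
have ord2 (j : 'I_2) : j = ord0 \/ j = ord_max.
  by case: j => -[|[|//]] ?; [left|right]; apply: val_inj.
have kge j x : (0 <= k j * x) = (0 <= (-1) ^+ j.+1 * (e * x)).
  have sg0 : Num.sg (k ord0) = - e.
    rewrite /e; have [j0] := cover 1; have [j1] := cover (-1).
    rewrite mulrN1 mulr1 oppr_ge0.
    by case: (ord2 j0) => ->; case: (ord2 j1) => -> l1 l2;
      case: (sgrP (k ord0)) kk0 l1 l2 => //; case: (sgrP (k ord_max)) k1 => //;
      rewrite ?opprK // => ? _ ? _ ? ?; exfalso; lra.
  rewrite -sgr_ge0 sgrM; case: (ord2 j) => ->.
    by rewrite sg0 expr1 mulN1r -mulNr -[RHS]sgr_ge0 sgrM sgrN /e sgr_id.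
  by rewrite /= sqrrN expr1n mul1r -[RHS]sgr_ge0 sgrM /e sgr_id.
exists ((e%:C%C * al) *: v), (e%:C%C * al * b1).
have hE z : hdot ((e%:C%C * al) *: v) z = e%:C%C * al * b1 + e%:C%C * U z.
  by rewrite hdotZl /U [e%:C%C * (al * _)]mulrA -mulrDr addrC subrK.
have eC0 : e%:C%C != 0 :> R[i] by rewrite eq_complex /= negb_and e0.
split.
- by rewrite scaler_eq0 negb_or mulf_neq0.
- move=> j; have [_ ->] := kP j.
  have s2 : (-1) ^+ j.+1 * (-1) ^+ j.+1 = 1 :> R by rewrite -expr2 sqrr_sign.
  apply/seteqP; split=> z /=.
    move=> [zI]; rewrite kge => t0; exists ((-1) ^+ j.+1 * (e * complex.Re (U z))) => //.
    rewrite hE [_ * (e * _) * _]mulrAC s2 mul1r; congr (_ + _).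
    by case: (U z) zI => x y /= ->; simpc.
  move=> [t t0]; rewrite hE => /addrI UE.
  have -> : U z = (e * (t * (-1) ^+ j.+1))%:C%C.
    by apply: (mulfI eC0); rewrite UE -rmorphM (mulrA e e) e2 mul1r.
  by split=> //=; rewrite kge (mulrA e e) e2 mul1r mulrCA s2 mulr1.
- rewrite CU; apply/seteqP; split=> z /=; rewrite hE.
    by move=> ->; rewrite mulr0 addr0.
  move=> /eqP; rewrite -subr_eq0 addrAC subrr add0r mulf_eq0 (negbTE eC0) /=.
  by move=> /eqP.
Qed.

End ComplexFanFormula.

(* Main.v *)
(** A color class with fewer than [r] points must lie in the center of an
    equidistributing [r]-fan, so all colors but one can be used to pin the
    center down.

    (a) Let the small classes be a vertex set of a simplex in R^p, and project
    along its span.  The last class becomes [D + q] vectors, the columns of a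
    matrix [Y], where [q = d + l] and [D + q <= (r - 1) q]; the assumption on
    [l] is exactly this inequality.  Choose [Y] as the Gale dual of a generic
    [(D + q) x q] matrix [W], i.e. [Y W = 0].  Scaling the normals of the fan so
    that they sum to zero gives row vectors [G_j] with [G_j W = 0] and
    [sum_j G_j = 0].  A point inside the blade [B_j] sees only [G_(j-1)] and
    [G_j], with opposite values, so [G_j = h_j - h_(j+1)] where [h_j] is
    supported on [B_j].  Hence all [h_j W] coincide.  Their supports have at
    most [q] elements each and at most [(r - 1) q] in total, and a dimension
    count for generic [W] forces every [h_j] to vanish.

    (b) Let the center contain [0] and the first [m - 2] basis vectors, and let
    the last class contain real and imaginary multiples of every other basis
    vector.  All of them lie in a real hyperplane through [0] only if the
    normal vector is zero. *)

Require Import Defs.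
From mathcomp Require Import finmap boolp classical_sets reals.
From mathcomp Require Import all_boot all_order all_algebra.
From mathcomp Require Import zify lra.

Set Implicit Arguments.
Unset Strict Implicit.
Unset Printing Implicit Defensive.

Import Order.TTheory GRing.Theory Num.Theory.

Local Open Scope ring_scope.

(** * Generic full row rank in affine families of matrices *)

Lemma poly_nonroot (F : numFieldType) (p : {poly F}) :
  p != 0 -> exists t, p.[t] != 0.
Proof.
move=> p0; pose s := [seq i%:R : F | i <- iota 0 (size p)].
have us : uniq s by rewrite map_inj_uniq ?iota_uniq//; exact: (mulrIn (oner_neq0 F)).
have [/(max_poly_roots p0)/(_ us)|/allPn[t _ pt]] := boolP (all (root p) s).
  by rewrite size_map size_iota ltnn.
by exists t.
Qed.

(** A right inverse at [t0] yields a determinant that is polynomial in [t] with value 1 at [t0];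
    wherever it does not vanish, full row rank persists. *)
Lemma row_free_line (F : fieldType) a b (A0 A1 : 'M[F]_(a, b)) t0 :
  row_free (A0 + t0 *: A1) ->
  exists2 p : {poly F}, p != 0 & forall t, p.[t] != 0 -> row_free (A0 + t *: A1).
Proof.
move=> /row_freeP[B AB].
pose Q := map_mx polyC (A0 *m B) + 'X *: map_mx polyC (A1 *m B).
have QE t : (\det Q).[t] = \det ((A0 + t *: A1) *m B).
  rewrite -/(horner_eval t _) -det_map_mx; congr (\det _).
  rewrite mulmxDl -scalemxAl /Q; move: (A0 *m B) (A1 *m B) => X0 X1.
  by apply/matrixP => i j; rewrite !mxE /= /horner_eval !hornerE.
exists (\det Q) => [|t].
  by apply: contraTneq (oner_neq0 F) => Q0; rewrite -(det1 F a) -AB -(QE t0) Q0 horner0 eqxx.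
rewrite QE => d; apply/row_freeP; exists (B *m invmx ((A0 + t *: A1) *m B)).
by rewrite mulmxA mulmxV// unitmxE unitfE.
Qed.

(** On the line joining a parameter good for the earlier indices to one good for the next index,
    each index excludes only the roots of a nonzero polynomial, as [A i] is affine with linear part
    [L i]. *)
Lemma generic_row_free (F : numFieldType) (E : lmodType F) (I : finType) a b
    (A L : I -> E -> 'M[F]_(a, b)) :
  (forall i w0 t w1, A i (w0 + t *: w1) = A i w0 + t *: L i w1) ->
  (forall i, exists w, row_free (A i w)) ->
  exists w, forall i, row_free (A i w).
Proof.
move=> AL ex.
suff [w wP] : exists w, forall i, i \in enum I -> row_free (A i w).
  by exists w => i; apply: wP; rewrite mem_enum.
elim: (enum I) => [|i s [w wP]]; first by exists 0.
have [w' w'P] := ex i; pose v := w' - w.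
have good j t0 : row_free (A j (w + t0 *: v)) -> exists2 p : {poly F}, p != 0 &
    forall t, p.[t] != 0 -> row_free (A j (w + t *: v)).
  by rewrite AL => /row_free_line[p p0 pP]; exists p => // t /pP; rewrite AL.
suff [p p0 pP] : exists2 p : {poly F}, p != 0 &
    forall t, p.[t] != 0 -> forall j, j \in i :: s -> row_free (A j (w + t *: v)).
  by have [t /pP tP] := poly_nonroot p0; exists (w + t *: v).
have {ex w'P}[p p0 pP] : exists2 p : {poly F}, p != 0 &
    forall t, p.[t] != 0 -> row_free (A i (w + t *: v)).
  by apply: (good _ 1); rewrite scale1r /v addrC subrK.
elim: s wP => [|j s IH] wP.
  by exists p => // t /pP ? j; rewrite inE => /eqP->.
have [j' jw|p1 p10 p1P] := IH; first by apply: wP; rewrite inE jw orbT.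
have [|p2 p20 p2P] := good j 0; first by rewrite scale0r addr0 wP ?mem_head.
exists (p1 * p2) => [|t]; first by rewrite mulf_neq0.
rewrite hornerM mulf_eq0 negb_or => /andP[/p1P h1 /p2P h2] e.
rewrite !inE orbCA => /orP[/eqP->//|ei]; apply: h1; by rewrite inE.
Qed.

(** * Cyclic labelling of disjoint blocks *)

Section CyclicPosition.
Variables (M q r : nat) (g : 'I_M -> nat).
(** Lexicographic order, fiber first: indices are below [M], so fibers do not interleave. *)
Let key (c : 'I_M) : nat := (g c * M + c)%N.
(* The position of [c] when the fibers of [g] are listed one after another. *)
Definition cyc_pos (c : 'I_M) : nat := #|[set e | (key e < key c)%N]|.

Lemma cyc_key_inj : injective key.
Proof.
move=> c c' /(congr1 (modn^~ M)); rewrite /key !modnMDl !modn_small//.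
exact: val_inj.
Qed.

Lemma cyc_pos_lt c : (cyc_pos c < M)%N.
Proof.
have <- : #|[set: 'I_M]| = M by rewrite cardsT card_ord.
apply: proper_card; apply/properP; split; first exact: subsetT.
by exists c; rewrite ?inE // ltnn.
Qed.

(** The elements from [c] up to but excluding [c'] lie in a single fiber, which also contains [c'],
    so there are fewer than [q] of them. *)
Lemma cyc_pos_block c c' : (key c < key c')%N -> g c = g c' ->
  (#|[set e | g e == g c]| <= q)%N -> (cyc_pos c < cyc_pos c' < cyc_pos c + q)%N.
Proof.
move=> lt gE le.
have mono e e' : (key e <= key e')%N -> (g e <= g e')%N.
  rewrite /key => h; rewrite leqNgt; apply/negP => l.
  have := leq_mul2r M (g e').+1 (g e); rewrite l orbT mulSn => l'.
  have := ltn_ord e'; lia.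
pose J := [set e | (key c <= key e < key c')%N].
have posE : cyc_pos c' = (cyc_pos c + #|J|)%N.
  rewrite -cardsUI [X in (_ + #|pred_of_set X|)%N](_ : _ = set0) ?cards0 ?addn0.
    by congr #|pred_of_set _|; apply/setP => e; rewrite !inE; lia.
  by apply/setP => e; rewrite !inE; lia.
have J0 : (0 < #|J|)%N by apply/card_gt0P; exists c; rewrite inE leqnn.
have Jq : (#|J| < q)%N.
  apply: leq_trans le; apply: proper_card; apply/properP; split.
    apply/subsetP => e; rewrite !inE => /andP[l1 l2].
    have := mono _ _ l1; have := mono _ _ (ltnW l2); lia.
  by exists c'; rewrite !inE ?gE ?ltnn ?andbF.
by rewrite posE; lia.
Qed.

Lemma cyc_pos_inj : injective cyc_pos.
Proof.
suff H c c' : (key c < key c')%N -> (cyc_pos c < cyc_pos c')%N.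
  move=> c c' e; apply: cyc_key_inj.
  by case: (ltngtP (key c) (key c')) => // /H; rewrite e ltnn.
move=> lt; apply: proper_card; apply/properP; split.
  by apply/subsetP => e; rewrite !inE; lia.
by exists c; rewrite !inE ?ltnn.
Qed.

End CyclicPosition.

(** Label by position modulo [q]: a block fills at most [q] consecutive positions, so its labels
    differ, and each label occurs at most [r - 1] times, so it misses one of the [r] blocks. *)
Lemma cyclic_labelling (M q r : nat) (f : 'I_M -> option 'I_r) :
  (0 < q)%N -> (0 < r)%N -> (M <= (r - 1) * q)%N ->
  (forall j, (#|[set c | f c == Some j]| <= q)%N) ->
  exists h : 'I_M -> 'I_q,
    (forall c c' j, f c = Some j -> f c' = Some j -> h c = h c' -> c = c') /\
    (forall k, exists j, forall c, f c = Some j -> h c != k).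
Proof.
move=> q0 r0 Mr le.
(* Elements outside all blocks get the extra value [r] and are listed last. *)
pose g c : nat := if f c is Some j then j : nat else r.
have gE (j : 'I_r) c : (g c == j) = (f c == Some j).
  by rewrite /g; case: (f c) => [j'|] //; rewrite gtn_eqF.
pose p := cyc_pos g.
exists (fun c => Ordinal (ltn_pmod (p c) q0)); split.
  move=> c c' j fc fc' [e].
  wlog lt : c c' fc fc' e / (g c * M + c < g c' * M + c')%N.
    move=> W; case: (ltngtP (g c * M + c) (g c' * M + c'))%N.
    - exact: W.
    - by move=> ?; symmetry; apply: W.
    - by move/cyc_key_inj.
  have gc : g c = j by rewrite /g fc.
  have gc' : g c' = j by rewrite /g fc'.
  have := @cyc_pos_block M q g c c' lt; rewrite gc gc' => /(_ erefl).
  have -> : [set e0 | g e0 == j] = [set c | f c == Some j].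
    by apply/setP => ?; rewrite !inE gE.
  rewrite -/p => /(_ (le j)) /andP[l1 l2].
  have := divn_eq (p c) q; have := divn_eq (p c') q; rewrite e => e1 e2.
  move: l1 l2; rewrite e1 e2 ltn_add2r ltn_mul2r q0 /= => l1.
  have := leq_mul2r q (p c %/ q).+1 (p c' %/ q); rewrite l1 orbT mulSn; lia.
move=> k.
have [/existsP[j /forallP jP]|] :=
    boolP [exists j, [forall c, (f c == Some j) ==> (p c %% q != k)%N]].
  by exists j => c /eqP fc; have := jP c; rewrite fc.
rewrite negb_exists => /forallP H.
have /fin_all_exists[s sP] j : exists c, f c = Some j /\ (p c %% q)%N = k.
  have := H j; rewrite negb_forall => /existsP[c].
  by rewrite negb_imply negbK => /andP[/eqP? /eqP?]; exists c.
(* Positions [p (s j)] have equal remainders, hence [r] distinct quotients, all below [r - 1]. *)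
have tP j : (p (s j) %/ q < r - 1)%N.
  by rewrite ltn_divLR//; apply: leq_trans Mr; exact: cyc_pos_lt.
have : injective (fun j => Ordinal (tP j)).
  move=> j j' [e]; have := divn_eq (p (s j)) q; rewrite e (sP j).2 -(sP j').2 -divn_eq.
  by move=> /cyc_pos_inj E; have := (sP j).1; rewrite E (sP j').1 => -[].
by move=> /leq_card; rewrite !card_ord; lia.
Qed.

(** * Generic weight matrices *)

Section GenericWeights.
Variables (F : numFieldType) (M q r : nat).
Implicit Types (f : 'I_M -> option 'I_r) (W : 'M[F]_(M, q)).

Definition block_sums f W : 'M[F]_(M, r * q) :=
  \matrix_c mxvec (\matrix_(j, k) ((f c == Some j)%:R * W c k)).

(** Linear system in the unknowns [x] and [v]: every block sum equals [v], and [x] vanishes outside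
    the blocks. It is affine in [W], as genericity requires. *)
Definition fan_mx f W : 'M[F]_(M + q, r * q + M) :=
  block_mx (block_sums f W) (diag_mx (\row_c (f c == None)%:R))
           (\matrix_l mxvec (\matrix_(j, k) - (l == k)%:R)) 0.

Lemma fan_mx_line f W0 t W1 :
  fan_mx f (W0 + t *: W1) = fan_mx f W0 + t *: block_mx (block_sums f W1) 0 0 0.
Proof.
rewrite scale_block_mx add_block_mx !scaler0 !addr0; congr block_mx.
apply/row_matrixP => c; rewrite !(linearD, linearZ) /= !rowK -linearZ -linearD.
by congr mxvec; apply/matrixP => j k; rewrite !mxE mulrDr mulrCA.
Qed.

Lemma mul_fan_mx f W (x : 'rV_M) (v : 'rV_q) :
  row_mx x v *m fan_mx f W =
  row_mx (mxvec (\matrix_(j, k) (\sum_(c | f c == Some j) x 0 c * W c k - v 0 k)))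
         (\row_c (x 0 c *+ (f c == None))).
Proof.
rewrite mul_row_block mulmx0 addr0; congr row_mx; last first.
  by apply/rowP => c; rewrite mul_mx_diag !mxE mulr_natr.
rewrite !mulmx_sum_row (eq_bigr _ (fun i _ => congr1 _ (rowK _ i))).
under [X in _ + X]eq_bigr do rewrite rowK -linearZ.
under eq_bigr do rewrite -linearZ.
rewrite -!linear_sum -linearD; congr mxvec; apply/matrixP => j k.
rewrite mxE !summxE [RHS]mxE; congr (_ + _).
  rewrite [RHS]big_mkcond; apply: eq_bigr => c _; rewrite !mxE.
  by case: ifP; rewrite ?mul1r ?mul0r ?mulr0.
rewrite (bigD1 k)//= big1 => [|l lk]; first by rewrite !mxE eqxx mulrN1 addr0.
by rewrite !mxE (negbTE lk) oppr0 mulr0.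
Qed.

(* The columns [f c == None] only make the coordinates of [x] outside the blocks
   harmless. *)
Lemma fan_mxP f W : row_free (fan_mx f W) <->
  forall (x : 'I_M -> F) (v : 'rV_q),
    (forall j k, \sum_(c | f c == Some j) x c * W c k = v 0 k) ->
    (v = 0 /\ forall c, f c -> x c = 0).
Proof.
split=> [fr x v xv|H].
  (* Coordinates outside the blocks do not enter the sums, so they may be set to zero. *)
  pose y := \row_c (if f c then x c else 0).
  have /eqP : row_mx y v *m fan_mx f W = 0.
    rewrite mul_fan_mx (_ : mxvec _ = 0).
      rewrite (_ : \row_c _ = 0) ?row_mx0//.
      by apply/rowP => c; rewrite !mxE; case: (f c) => //=; rewrite mul0rn.
    apply/eqP; rewrite mxvec_eq0; apply/eqP/matrixP => j k; rewrite !mxE -(xv j k).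
    apply/eqP; rewrite subr_eq0; apply/eqP; apply: eq_bigr => c /eqP fc.
    by rewrite mxE fc.
  rewrite mulmx_free_eq0// row_mx_eq0 => /andP[/eqP y0 /eqP v0]; split=> // c fc.
  by have /rowP/(_ c) := y0; rewrite !mxE fc.
apply: inj_row_free => z; rewrite -[z]hsubmxK mul_fan_mx => /eqP.
rewrite row_mx_eq0 mxvec_eq0 => /andP[/eqP/matrixP e1 /eqP/rowP e2].
have [j k|v0 x0] := H ((lsubmx z) 0) (rsubmx z).
  by apply/eqP; rewrite -subr_eq0; have := e1 j k; rewrite !mxE => ->.
rewrite v0 (_ : lsubmx z = 0) ?row_mx0//; apply/rowP => c.
have := e2 c; have := x0 c; rewrite !mxE.
by case: (f c) => [a /(_ isT)|].
Qed.

(* The spans of [r] disjoint blocks of rows have codimensions adding up to at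
   least [q], so generically they meet in [0].  A special [W] for a given [f]
   has standard basis vectors as rows, assigned cyclically along the blocks. *)
Lemma generic_weights : (0 < q)%N -> (0 < r)%N -> (M <= (r - 1) * q)%N ->
  exists W, forall f, (forall j, (#|[set c | f c == Some j]| <= q)%N) ->
    forall (x : 'I_M -> F) (v : 'rV_q),
    (forall j k, \sum_(c | f c == Some j) x c * W c k = v 0 k) ->
    forall c, f c -> x c = 0.
Proof.
move=> q0 r0 Mr.
(* Encoding the assignments as finite functions leaves finitely many conditions on [W]. *)
pose good (f : {ffun 'I_M -> option 'I_r}) :=
  [forall j, (#|[set c | f c == Some j]| <= q)%N].
have [|i|W WP] := @generic_row_free F 'M[F]_(M, q) {f | good f} _ _
    (fun i => fan_mx (sval i)) (fun i W => block_mx (block_sums (sval i) W) 0 0 0).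
- by move=> i W0 t W1; exact: fan_mx_line.
- have [h [hi hm]] := cyclic_labelling q0 r0 Mr (forallP (svalP i)).
  exists (\matrix_(c, k) (h c == k)%:R); apply/fan_mxP => x v xv.
  (* Some block misses label [k], so its sum has [k]-th coordinate zero. *)
  have v0 : v = 0.
    apply/rowP => k; have [j jk] := hm k; rewrite -(xv j k) mxE big1// => c /eqP /jk.
    by rewrite mxE => /negbTE->; rewrite mulr0.
  split=> // c; case fc : (sval i c) => [j|//] _.
  have := xv j (h c); rewrite v0 mxE (bigD1 c) ?fc //= mxE eqxx mulr1.
  rewrite big1 ?addr0// => c' /andP[/eqP fc' cc']; rewrite mxE.
  by case: eqP => [e|]; rewrite ?mulr0//; move: cc'; rewrite (hi _ _ _ fc' fc e) eqxx.
exists W => f fq x v xv c fc.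
pose f' := [ffun c => f c].
have gf : good f'.
  apply/forallP => j; rewrite (eq_card (B := [set c | f c == Some j]))// => e.
  by rewrite !inE ffunE.
have /fan_mxP/(_ x v) := WP (exist _ f' gf).
case=> [j k|_ /(_ c)]; last by rewrite /= ffunE => /(_ fc).
by rewrite -(xv j k); apply: eq_bigl => e; rewrite /= ffunE.
Qed.
End GenericWeights.

(** * Colored point families and equidistribution *)

Section ColoredFamily.
Variables (V : choiceType) (T : finType) (m : nat).
Variables (pt : T -> V) (col : T -> 'I_m).
Hypothesis pt_inj : injective pt.
Hypothesis col_surj : forall i, exists t, col t = i.

Definition point_set : {fset V} := [fset pt t | t in T]%fset.
Definition color_class (i : 'I_m) : {fset V} :=
  [fset pt t | t in [set t | col t == i]]%fset.

Lemma point_setP x : reflect (exists t, x = pt t) (x \in point_set).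
Proof.
by apply: (iffP (imfsetP _ _ _ _)) => [[t _ ->]|[t ->]]; exists t.
Qed.

Lemma card_point_set : #|` point_set| = #|T|.
Proof. by rewrite card_imfset //= cardE. Qed.

Lemma card_imfset_set (A : {set T}) : #|` [fset pt t | t in A]%fset| = #|A|.
Proof. by rewrite card_imfset //= -cardE. Qed.

Lemma mem_color_class t i : (pt t \in color_class i) = (col t == i).
Proof. by rewrite mem_imfset //= inE. Qed.

Lemma color_class_coloring : is_coloring point_set color_class.
Proof.
split=> [i|i j ij|x].
- have [t ti] := col_surj i; apply/fset0Pn; exists (pt t).
  by rewrite mem_color_class ti.
- apply/fdisjointP => x /imfsetP[t /=]; rewrite inE => /eqP ti ->.
  by rewrite mem_color_class ti.
- apply/point_setP/existsP => [[t ->]|[i /imfsetP[t _ ->]]]; last by exists t.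
  by exists (col t); rewrite mem_color_class.
Qed.

Lemma equidistributes_family r (B : 'I_r.+1 -> set V) C :
  equidistributes B C point_set color_class ->
  (forall t, exists j, B j (pt t)) /\
  forall j i, (#|[set t | (col t == i) && `[< B j (pt t) /\ ~ C (pt t) >]]| * r.+1
                 <= #|[set t | col t == i]|)%N.
Proof.
move=> [sub le]; split=> [t|j i].
  have [|j _ Bj] := sub (pt t); last by exists j.
  by apply/point_setP; exists t.
have := le j i; rewrite ler_pdivlMr ?ltr0n// -natrM ler_nat.
rewrite [#|` color_class i|]card_imfset_set.
congr (_ * _ <= _)%N; rewrite -card_imfset_set.
congr #|` _|; apply/fsetP => x; rewrite in_fsetE /=.
apply/andP/imfsetP => [[/imfsetP[t /=]]|[t /=]].
  rewrite inE => ti -> /set_mem Bt; exists t => //=.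
  by rewrite inE ti; apply/asboolP.
rewrite inE => /andP[ti /asboolP Bt] ->; rewrite mem_color_class; split=> //.
exact: mem_set.
Qed.

(** The interior of a blade holds at most [r / r.+1] points of the class, hence none. *)
Lemma small_class_center r (B : 'I_r.+1 -> set V) C t :
  equidistributes B C point_set color_class ->
  (#|[set t' | col t' == col t]| <= r)%N -> C (pt t).
Proof.
move=> /equidistributes_family[cov le] small; apply: contrapT => nC.
have [j Bj] := cov t; have := leq_trans (le j (col t)) small.
rewrite leqNgt => /negP[]; apply: leq_pmull.
by apply/card_gt0P; exists t; rewrite inE eqxx; apply/asboolP.
Qed.

End ColoredFamily.

(** Biject the vertices with an [m] by [r] grid and color by the first coordinate. *)
Lemma exists_balanced_map p m r : p.+1 = (m * r)%N ->
  exists g : option 'I_p -> 'I_m,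
    (forall i, exists o, g o = i) /\
    (forall i, (#|[set o | g o == i]| <= r)%N).
Proof.
move=> E.
have card : #|{: option 'I_p}| = #|{: 'I_m * 'I_r}|.
  by rewrite card_option card_prod !card_ord.
pose g (o : option 'I_p) : 'I_m * 'I_r := enum_val (cast_ord card (enum_rank o)).
have gi : injective g.
  by move=> x y /enum_val_inj/cast_ord_inj/enum_rank_inj.
exists (fun o => (g o).1); split=> i.
  have r0 : (0 < r)%N by case: (r) E; lia.
  exists (enum_val (cast_ord (esym card) (enum_rank (i, Ordinal r0)))).
  by rewrite /g enum_valK cast_ordKV enum_rankK.
rewrite -[leqRHS]card_ord -(card_in_imset (f := fun o => (g o).2)) ?max_card//.
move=> x y; rewrite !inE => /eqP x1 /eqP y1 xy; apply: gi.
by rewrite [g x]surjective_pairing x1 -y1 xy -surjective_pairing.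
Qed.

(* All but one of the color classes have at most [r] points, so a fan with
   [r.+1] blades equidistributes them only if its center contains them. *)
Lemma colored_configuration (V : choiceType) p M m r
    (a : option 'I_p -> V) (y : 'I_M -> V) :
  p.+1 = (m * r)%N -> (0 < M)%N -> injective a -> injective y ->
  (forall o t, a o <> y t) ->
  exists (X : {fset V}) (c : 'I_m.+1 -> {fset V}),
    [/\ #|` X| = (p.+1 + M)%N,
        (forall o, a o \in X) /\ (forall t, y t \in X),
        is_coloring X c &
        forall (B : 'I_r.+1 -> set V) C, equidistributes B C X c ->
          [/\ forall o, C (a o), forall t, exists j, B j (y t) &
              forall j, (#|[set t | `[< B j (y t) /\ ~ C (y t) >]]| * r.+1 <= M)%N]].
Proof.
move=> E M0 ai yi ay; have [g [gs gl]] := exists_balanced_map E.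
pose pt (t : option 'I_p + 'I_M) := match t with inl o => a o | inr t => y t end.
(* The points [y t] form the last class; the simplex vertices share the other [m] colors. *)
pose col (t : option 'I_p + 'I_M) : 'I_m.+1 :=
  if t is inl o then lift ord_max (g o) else ord_max.
have pti : injective pt.
  move=> [o|t] [o'|t'] /=; last by move/yi->.
  - by move/ai->.
  - by move/ay.
  - by move/esym/ay.
have cols i : exists t, col t = i.
  case: (unliftP ord_max i) => [j ->|->]; last by exists (inr (Ordinal M0)).
  by have [o <-] := gs j; exists (inl o).
exists (point_set pt), (color_class pt col); split.
- by rewrite card_point_set // card_sum card_option !card_ord.
- by split=> [o|t]; apply/point_setP; [exists (inl o)|exists (inr t)].
- exact: color_class_coloring.
move=> B C eq; have [cov le] := equidistributes_family pti eq; split=> [o|t|j].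
- apply: (small_class_center (t := inl o) pti eq).
  apply: leq_trans (gl (g o)); rewrite -[leqRHS](card_imset _ (@inl_inj _ 'I_M)).
  apply: subset_leq_card; apply/subsetP => -[o'|t']; rewrite !inE /=.
    by move/eqP/lift_inj => e; apply: imset_f; rewrite inE e.
  by move=> h; have := neq_lift ord_max (g o); rewrite h.
- exact: (cov (inr t)).
have last (P : pred 'I_M) : #|[set t | (col t == ord_max) && (if t is inr t then P t else true)]| = #|[set t | P t]|.
  rewrite -[RHS](card_imset _ (@inr_inj (option 'I_p) _)); congr #|pred_of_set _|.
  apply/setP => -[o|t]; rewrite !inE.
    by rewrite eq_sym (negbTE (neq_lift _ _)); apply/esym/negP => /imsetP[].
  by rewrite eqxx mem_imset ?inE//; exact: inr_inj.
have := le j ord_max.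
congr (_ * _ <= _)%N.
  rewrite -last; congr #|pred_of_set _|; apply/setP => -[o|t]; rewrite !inE //=.
  by rewrite eq_sym (negbTE (neq_lift _ _)).
apply: etrans (etrans (last predT) _).
  by congr #|pred_of_set _|; apply/setP => -[o|t]; rewrite !inE /= andbT.
by rewrite -[RHS]card_ord -cardsT; congr #|pred_of_set _|; apply/setP => ?; rewrite !inE.
Qed.

(** * Simplices, linear relations and Gale duality *)

Definition simplex_vertex (F : pzRingType) p (o : option 'I_p) : 'rV[F]_p :=
  if o is Some k then delta_mx 0 k else 0.

Lemma simplex_vertex_inj (F : nzRingType) p : injective (@simplex_vertex F p).
Proof.
move=> [k|] [k'|] //= /rowP e; last 2 first.
- by have := e k; rewrite !mxE !eqxx => /eqP; rewrite oner_eq0.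
- by have := e k'; rewrite !mxE !eqxx => /eqP; rewrite eq_sym oner_eq0.
have := e k; rewrite !mxE !eqxx /=; case: eqP => [->//|_] /eqP.
by rewrite oner_eq0.
Qed.

Lemma dot_row_mx (F : pzRingType) p q (a : 'rV[F]_(p + q))
    (x : 'rV_p) (y : 'rV_q) :
  \sum_i a 0 i * row_mx x y 0 i =
  \sum_i lsubmx a 0 i * x 0 i + \sum_i rsubmx a 0 i * y 0 i.
Proof.
by rewrite big_split_ord; congr (_ + _); apply: eq_bigr => i _;
  rewrite ?row_mxEl ?row_mxEr mxE.
Qed.

Lemma dot_simplex_vertex (F : pzRingType) p (a : 'rV[F]_p) k :
  \sum_i a 0 i * simplex_vertex F (Some k) 0 i = a 0 k.
Proof.
rewrite (bigD1 k)//= !mxE !eqxx mulr1 big1 ?addr0// => i ik.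
by rewrite mxE (negbTE ik) andbF mulr0.
Qed.

Lemma dot0r (F : pzRingType) p (a : 'rV[F]_p) :
  \sum_i a 0 i * (0 : 'rV[F]_p) 0 i = 0.
Proof. by rewrite big1// => i _; rewrite mxE mulr0. Qed.

Lemma hyperplane_simplex (F : fieldType) p q (a : 'rV[F]_(p + q)) b :
  (forall o, hyperplane a b (row_mx (simplex_vertex F o) 0)) ->
  b = 0 /\ lsubmx a = 0.
Proof.
move=> H; have b0 : b = 0.
  by have := H None; rewrite /hyperplane /= dot_row_mx !dot0r addr0.
split=> //; apply/rowP => k; have := H (Some k).
by rewrite /hyperplane /= dot_row_mx dot_simplex_vertex dot0r addr0 b0 !mxE.
Qed.

(** A zero coefficient in a dependency would leave a relation among the remaining, independent
    normals. *)
Lemma conical_fan_relation (F : fieldType) r D (N : 'M[F]_(r, D)) :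
  (forall j, row_free (row' j N)) -> ~~ row_free N ->
  exists u : 'rV_r, u *m N = 0 /\ forall j, u 0 j != 0.
Proof.
move=> free dep.
have [u [u0 uN]] : exists u : 'rV_r, u != 0 /\ u *m N = 0.
  apply: contrapT => H; case/negP: dep; apply: inj_row_free => v vN.
  by apply/eqP; apply: contrapT => /negP v0; apply: H; exists v.
exists u; split=> // j; apply: contraNneq u0 => uj.
have /eqP : col' j u *m row' j N = 0.
  rewrite -uN !mulmx_sum_row (bigD1_ord j) //= uj scale0r add0r.
  by apply: eq_bigr => i _; rewrite mxE; congr (_ *: _); apply/rowP => k; rewrite !mxE.
rewrite mulmx_free_eq0// => /eqP/rowP e; apply/eqP/rowP => i.
by case: (unliftP j i) => [k|] ->; rewrite ?mxE//; have := e k; rewrite !mxE.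
Qed.

Lemma ordS_invariant T r (s : 'I_r.+1 -> T) :
  (forall j, s j = s (ordS j)) -> forall j, s j = s ord0.
Proof.
move=> H [i lt]; elim: i lt => [|i IH] lt; first by congr s; apply: val_inj.
rewrite -(IH (ltnW lt)) (H (Ordinal (ltnW lt))); congr s; apply: val_inj => /=.
by rewrite modn_small.
Qed.

(** The left kernel of [W] has dimension at least [M - q = D]; take [D] independent vectors in
    it. *)
Lemma row_free_gale (F : fieldType) D M q (W : 'M[F]_(M, q)) : M = (D + q)%N ->
  exists2 Y : 'M[F]_(D, M), row_free Y & Y *m W = 0.
Proof.
move=> E; have le : (D <= \rank (kermx W))%N.
  by rewrite mxrank_ker; have := rank_leq_col W; lia.
exists (pid_mx D *m row_base (kermx W)).
  by rewrite /row_free mxrankMfree ?row_base_free// rank_pid_mx.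
apply/eqP; rewrite -mulmxA (_ : row_base _ *m _ = 0) ?mulmx0//.
by apply/sub_kermxP; rewrite eq_row_base.
Qed.

(** * Real case: obstruction to conical fans *)

Section NoConicalFan.
Variables (R : realType) (p D M q r : nat) (W : 'M[R]_(M, q)) (Y : 'M[R]_(D, M)).
Variables (a : 'I_M -> 'rV[R]_p).
Let y t : 'rV[R]_(p + D) := row_mx (a t) (row t Y^T).
Hypothesis W_generic : forall f : 'I_M -> option 'I_r.+3,
  (forall j, (#|[set c | f c == Some j]| <= q)%N) ->
  forall (x : 'I_M -> R) (v : 'rV_q),
  (forall j k, \sum_(c | f c == Some j) x c * W c k = v 0 k) ->
  forall c, f c -> x c = 0.
Hypotheses (Y_free : row_free Y) (YW : Y *m W = 0).

Lemma no_conical_fan (B : 'I_r.+3 -> set 'rV[R]_(p + D)) C :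
  conical_fan B C ->
  (forall o, C (row_mx (simplex_vertex R o) 0)) ->
  (forall t, exists j, B j (y t)) ->
  (forall j, (#|[set t | `[< B j (y t) /\ ~ C (y t) >]]| <= q)%N) -> False.
Proof.
move=> [N [b [N0 [Nfree Ndep _ BE CE]]]] Ca cov small.
have [u [uN u0]] := conical_fan_relation Nfree Ndep.
have bN i : b i = 0 /\ lsubmx (row i N) = 0.
  by apply: hyperplane_simplex => o; have := Ca o; rewrite CE => /(_ i I).
(* [E i t] is the value at [y t] of the linear form defining [H_i]: once the center contains the
   simplex, that form sees only the last [D] coordinates. *)
pose E := rsubmx N *m Y.
have HE i t : hyperplane (row i N) (b i) (y t) <-> E i t = 0.
  have [-> l0] := bN i; rewrite /hyperplane /= dot_row_mx l0.
  rewrite big1 ?add0r => [|k _]; last by rewrite mxE mul0r.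
  suff -> : \sum_k rsubmx (row i N) 0 k * row t Y^T 0 k = E i t by [].
  by rewrite mxE; apply: eq_bigr => k _; rewrite !mxE.
have HC t : C (y t) <-> forall i, E i t = 0.
  rewrite CE; split=> [h i|h i _]; last by apply/HE.
  by apply/HE; apply: h.
have HB j t i : B j (y t) -> i != ord_pred j -> i != j -> E i t = 0.
  by rewrite BE => -[_ h] ij1 ij2; apply/HE; apply: h; split.
pose G j t := u 0 j * E j t.
have sumG t : \sum_j G j t = 0.
  have /matrixP/(_ 0 t) : u *m E = 0 by rewrite /E mulmxA mulmx_rsub uN linear0 mul0mx.
  by rewrite !mxE.
have pred_neq (j : 'I_r.+3) : ord_pred j != j.
  apply/eqP => /(congr1 val) /=; case: j => -[|j] lt /=.
    by rewrite modn_small // => e.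
  by rewrite modnDr modn_small; lia.
have G2 j t : B j (y t) -> G (ord_pred j) t = - G j t.
  move=> Bj; have := sumG t; rewrite (bigD1 j)//= (bigD1 (ord_pred j)) ?pred_neq//=.
  rewrite big1 ?addr0 => [/eqP|i /andP[ij1 ij2]]; last by rewrite /G (HB j) ?mulr0.
  by rewrite addrC addr_eq0 => /eqP.
(* The blade having [y t] in its interior; [None] means that [y t] lies in the center. *)
pose f t : option 'I_r.+3 := [pick j | `[< B j (y t) /\ ~ C (y t) >]].
have fS t j : f t = Some j -> B j (y t).
  by rewrite /f; case: pickP => // j' /asboolP[Bj _] [<-].
have fN t : f t = None -> forall j, G j t = 0.
  rewrite /f; case: pickP => // nB _ j; suff /HC e : C (y t) by rewrite /G e mulr0.
  apply: contrapT => nC; have [j' Bj] := cov t.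
  by have /asboolP[] := nB j'.
have fq j : (#|[set t | f t == Some j]| <= q)%N.
  apply: leq_trans (small j); apply: subset_leq_card; apply/subsetP => t.
  by rewrite !inE /f; case: pickP => // j' h /eqP[<-].
pose x t := oapp (G^~ t) 0 (f t).
(* Column [t] of [G] is supported on [f t] and its cyclic predecessor, with opposite values. *)
have GE j t : G j t = (if f t == Some j then x t else 0)
                      - (if f t == Some (ordS j) then x t else 0).
  rewrite /x; case ft : (f t) => [j'|] /=; last by rewrite fN// subrr.
  have Bj := fS _ _ ft; rewrite !(inj_eq (@Some_inj _)).
  have [->|jj] := eqVneq j' j.
    by have := pred_neq (ordS j); rewrite ordSK => /negbTE->; rewrite subr0.
  have [e|jS] := eqVneq j' (ordS j).
    by rewrite sub0r -G2// e ordSK.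
  rewrite subrr /G (HB j') ?mulr0 // eq_sym//.
  by apply: contraNneq jS => <-; rewrite ord_predK.
pose s j := \row_k \sum_(t | f t == Some j) x t * W t k.
(* The difference is row [j] of [G W], a multiple of row [j] of [E W], which is zero since
   [Y W = 0]. *)
have sS j : s j = s (ordS j).
  apply/rowP => k; apply/eqP; rewrite -subr_eq0 !mxE.
  rewrite big_mkcond [X in _ - X]big_mkcond -sumrB /=.
  rewrite (eq_bigr (fun t => G j t * W t k)) => [|t _]; last first.
    by rewrite GE mulrBl; do 2 case: ifP; rewrite ?mul0r.
  have /matrixP/(_ j k) : E *m W = 0 by rewrite -mulmxA YW mulmx0.
  rewrite !mxE => EW; rewrite (eq_bigr (fun t => u 0 j * (E j t * W t k))) => [|t _].
    by rewrite -mulr_sumr EW mulr0.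
  by rewrite mulrA.
have x0 c : f c -> x c = 0.
  by apply: (W_generic fq (v := s ord0)) => j k; rewrite -(ordS_invariant sS j) mxE.
have E0 : E = 0.
  apply/matrixP => j t; rewrite [RHS]mxE.
  have : G j t = 0.
    rewrite GE; case ft : (f t) => [j'|] /=; last by rewrite subrr.
    by rewrite x0 ?ft//; do 2 case: ifP; rewrite subrr.
  by move/eqP; rewrite mulf_eq0 (negbTE (u0 j)) => /eqP.
have r0 : rsubmx N = 0 by apply/eqP; rewrite -(mulmx_free_eq0 _ Y_free) -/E E0.
have rN : rsubmx (row ord0 N) = row ord0 (rsubmx N) by apply/rowP => k; rewrite !mxE.
by have := N0 ord0; rewrite -[row _ _]hsubmxK (bN ord0).2 rN r0 row0 row_mx0 eqxx.
Qed.
End NoConicalFan.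

Lemma real_configuration (R : realType) (p D q r m N : nat) :
  (0 < p)%N -> p.+1 = (m * r.+2)%N -> (0 < q)%N -> (D + q <= r.+2 * q)%N ->
  N = (p + D)%N ->
  exists (X : {fset 'rV[R]_N}) (c : 'I_m.+1 -> {fset 'rV[R]_N}),
    [/\ #|` X| = (p.+1 + (D + q))%N, affinely_spanning X, is_coloring X c &
        forall (B : 'I_r.+3 -> set 'rV[R]_N) C,
          conical_fan B C -> ~ equidistributes B C X c].
Proof.
move=> p0 E q0 le ->.
have [||W WP] := @generic_weights R (D + q) q r.+3 q0 => //.
have [Y Yf YW] := row_free_gale W erefl.
(* The entries [t.+2] keep the points distinct from each other and from the simplex vertices, whose
   entries are 0 or 1. *)
pose a t : 'rV[R]_p := const_mx t.+2%:R.
pose y (t : 'I_(D + q)) : 'rV[R]_(p + D) := row_mx (a t) (row t Y^T).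
pose v o : 'rV[R]_(p + D) := row_mx (simplex_vertex R o) 0.
have vi : injective v by move=> o o' /eq_row_mx[/simplex_vertex_inj].
pose k0 := Ordinal p0.
have yi : injective y.
  move=> t t' /eq_row_mx[/rowP/(_ k0)]; rewrite !mxE => /eqP.
  by rewrite eqr_nat => /eqP[/val_inj].
have vy o t : v o <> y t.
  move=> /eq_row_mx[/rowP/(_ k0)]; case: o => [k|]; rewrite !mxE => /eqP.
    by rewrite -[_ (_ && _)]/(_ : nat) eqr_nat; case: (_ && _).
  by rewrite eq_sym pnatr_eq0.
have [|X [c [card [vX yX] col eqd]]] := colored_configuration E _ vi yi vy.
  by rewrite addn_gt0 q0 orbT.
exists X, c; split=> // [A b A0 sub|B C fan eq].
  have [b0 l0] : b = 0 /\ lsubmx A = 0.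
    by apply: hyperplane_simplex => o; apply: sub; exact: vX.
  have : rsubmx A *m Y = 0.
    apply/rowP => t; have := sub _ (yX t).
    rewrite /hyperplane /= dot_row_mx l0 b0 big1 ?add0r => [e|i _].
      rewrite [RHS]mxE -[RHS]e mxE; apply: eq_bigr => k _; rewrite !mxE //.
    by rewrite mxE mul0r.
  move/eqP; rewrite mulmx_free_eq0// => /eqP r0.
  by move: A0; rewrite -[A]hsubmxK l0 r0 row_mx0 eqxx.
have [Cv cov small] := eqd _ _ eq.
apply: (no_conical_fan WP Yf YW fan Cv cov) => j.
have := small j; set n := #|_| => sm.
(* A blade interior holds at most [(D + q) / r.+3] points, and [D + q <= r.+2 * q]. *)
have := leq_trans sm le => {}sm; have : (n * r.+3 <= q * r.+3)%N by nia.
by rewrite leq_pmul2r.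
Qed.

(** * Complex case: obstruction to regular 2-fans *)

Lemma complex_configuration (R : realType) (s D M N : nat) :
  (0 < D)%N -> (2 * D <= M)%N -> N = (s + D)%N ->
  exists (X : {fset 'rV[R[i]]_N}) (c : 'I_s.+2 -> {fset 'rV[R[i]]_N}),
    [/\ #|` X| = (s.+1 + M)%N, affinely_spanning X, is_coloring X c &
        forall (B : 'I_2 -> set 'rV[R[i]]_N) C,
          complex_regular_2fan B C -> ~ equidistributes B C X c].
Proof.
move=> D0 DM ->.
(* Parity selects a real or imaginary multiple; indices [2k] and [2k+1] share basis vector [k], and
   surplus indices wrap around modulo [D]. *)
pose z t : R[i] := if odd t then 'i%C *+ t.+2 else t.+2%:R.
have jP t : (t./2 %% D < D)%N by rewrite ltn_pmod.
pose y (t : 'I_M) : 'rV[R[i]]_(s + D) := row_mx 0 (z t *: delta_mx 0 (Ordinal (jP t))).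
pose v o : 'rV[R[i]]_(s + D) := row_mx (simplex_vertex _ o) 0.
(* [phi] separates the points: it is [0] or [1] on the simplex and [t.+2] at [y t]. *)
pose phi (x : 'rV[R[i]]_(s + D)) : R :=
  let u := \sum_k x 0 k in complex.Re u + complex.Im u.
have phiy t : phi (y t) = t.+2%:R.
  rewrite /phi /y big_split_ord /= big1 ?add0r => [|i _]; last by rewrite row_mxEl mxE.
  rewrite (bigD1 (Ordinal (jP t)))//= big1 ?addr0 => [|i it]; last first.
    by rewrite row_mxEr !mxE (negbTE it) mulr0.
  rewrite row_mxEr !mxE !eqxx mulr1 /z; case: ifP => _.
    by rewrite !raddfMn /= mul0rn add0r.
  by rewrite !raddfMn /= mul0rn addr0.
have phiv o : phi (v o) = (o != None)%:R.
  suff: \sum_k v o 0 k = (o != None)%:R.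
    by rewrite /phi => ->; case: (o != None); rewrite /= addr0.
  rewrite /v big_split_ord /= addrC big1 ?add0r => [|i _]; last by rewrite row_mxEr mxE.
  under eq_bigr do rewrite row_mxEl.
  case: o => [k|] /=; last by rewrite big1// => i _; rewrite mxE.
  rewrite (bigD1 k)//= big1 ?addr0 => [|i ik]; last by rewrite mxE (negbTE ik) andbF.
  by rewrite !mxE !eqxx.
have vi : injective v by move=> o o' /eq_row_mx[/simplex_vertex_inj].
have yi : injective y.
  move=> t t' /(congr1 phi)/eqP; rewrite !phiy eqr_nat => /eqP[].
  exact: val_inj.
have vy o t : v o <> y t.
  by move=> /(congr1 phi)/eqP; rewrite phiv phiy eqr_nat; case: o.
(* With two blades the small classes are singletons: [s.+1] vertices in [s.+1] classes. *)
have [||X [c [card [vX yX] col eqd]]] :=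
    @colored_configuration _ s M s.+1 1 v y _ _ vi yi vy.
- by rewrite muln1.
- by apply: leq_trans _ DM; rewrite muln_gt0.
have coord (A : 'rV[R[i]]_(s + D)) t : lsubmx A = 0 ->
    \sum_k A 0 k * y t 0 k = rsubmx A 0 (Ordinal (jP t)) * z t.
  move=> l0; rewrite dot_row_mx l0 dot0r add0r (bigD1 (Ordinal (jP t)))//= !mxE.
  rewrite !eqxx mulr1 big1 ?addr0// => i it.
  by rewrite !mxE (negbTE it) !mulr0.
have zt (b : bool) (k : 'I_D) : exists t : 'I_M, odd t = b /\ Ordinal (jP t) = k.
  have lt : (b + k.*2 < M)%N.
    by apply: leq_trans _ DM; have := ltn_ord k; case: (b) => /=; lia.
  exists (Ordinal lt); rewrite /= oddD odd_double oddb addbF; split=> //.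
  by apply: val_inj; rewrite /= half_bit_double modn_small.
have z0 t : z t != 0.
  rewrite /z; case: ifP => _; last by rewrite pnatr_eq0.
  by rewrite mulrn_eq0 /= eq_complex /= oner_eq0 andbF.
exists X, c; split=> // [A b A0 sub|B C fan eq].
  have [b0 l0] : b = 0 /\ lsubmx A = 0.
    by apply: hyperplane_simplex => o; apply: sub; exact: vX.
  have r0 : rsubmx A = 0.
    apply/rowP => k; have [t [_ tk]] := zt false k.
    have := sub _ (yX t); rewrite /hyperplane /= coord// b0 tk => /eqP.
    by rewrite mulf_eq0 (negbTE (z0 t)) orbF => /eqP->; rewrite mxE.
  by move: A0; rewrite -[A]hsubmxK l0 r0 row_mx0 eqxx.
have [Cv cov _] := eqd _ _ eq.
have [u [b [u0 BE CE]]] := (complex_regular_2fanP B C).1 fan.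
pose A := map_mx (@conjc R) u.
have AE (x : 'rV[R[i]]_(s + D)) : \sum_k A 0 k * x 0 k = (hdot u x)^*%C.
  by rewrite rmorph_sum; apply: eq_bigr => i _; rewrite mxE rmorphM /= conjcK.
have [b0 l0] : b^*%C = 0 /\ lsubmx A = 0.
  apply: hyperplane_simplex => o; rewrite hyperplane_hdot.
  by have := Cv o; rewrite CE.
have {}b0 : b = 0 by rewrite -[b]conjcK b0 conjc0.
(* With the center through 0, the form defining it takes real values on the whole fan. *)
have real (t : 'I_M) : complex.Im (rsubmx A 0 (Ordinal (jP t)) * z t) = 0.
  rewrite -coord// AE; have [j] := cov t; rewrite BE => -[x _ ->].
  by rewrite b0 add0r /= oppr0.
suff r0 : rsubmx A = 0.
  have : A = 0 by rewrite -[A]hsubmxK l0 r0 row_mx0.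
  by move/eqP; rewrite map_mx_eq0 (negbTE u0).
(* Nonzero real and imaginary multiples of the coefficient are both real, so it vanishes. *)
apply/rowP => k; rewrite [RHS]mxE.
have [t [te tk]] := zt false k; have [t' [to tk']] := zt true k.
move: (real t) (real t'); rewrite tk tk' /z te to.
case: (rsubmx A 0 k) => x x'; rewrite !mulrnAr mulr1 !raddfMn /= mulr0 mulr1 addr0.
move=> /eqP; rewrite mulrn_eq0 /= => /eqP->.
by move=> /eqP; rewrite mulrn_eq0 /= => /eqP->.
Qed.

(** * Choice of parameters in both cases *)

Theorem proposition8p4 (R : realType) (d m : nat) (hd : (1 <= d)%N)
    (hm : (2 <= m)%N) :
  (forall r k n l : nat,
      (3 <= r)%N ->
      n = ((r - 1) * (d + m + 1) + k + 1)%N ->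
      2%:R + (k + 2)%:R / (r - 2)%:R < l%:R :> rat ->
      exists (X : {fset 'rV[R]_(n - d - 1)})
             (c : 'I_m -> {fset 'rV[R]_(n - d - 1)}),
        [/\ #|` X| = (n + l)%N,
            affinely_spanning X,
            is_coloring X c &
            forall (B : 'I_r -> set 'rV[R]_(n - d - 1))
                   (C : set 'rV[R]_(n - d - 1)),
              conical_fan B C -> ~ equidistributes B C X c])
  /\
  (forall k n l : nat,
      n = (2 * (d + 1) + m + k)%N ->
      (k + 3 < l)%N ->
      exists (X : {fset 'rV[R[i]]_(n - d - 1)})
             (c : 'I_m -> {fset 'rV[R[i]]_(n - d - 1)}),
        [/\ #|` X| = (n + l)%N,
            affinely_spanning X,
            is_coloring X c &
            forall (B : 'I_2 -> set 'rV[R[i]]_(n - d - 1))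
                   (C : set 'rV[R[i]]_(n - d - 1)),
              complex_regular_2fan B C -> ~ equidistributes B C X c]).
Proof.
case: m hm => [|[|s]]// _; split.
  move=> [|[|[|r]]]// k n l _ nE; rewrite subn2 /= -ltrBrDl ltr_pdivrMr ?ltr0n//.
  move=> lt.
  (* The bound on [l] with denominators cleared; [r] now stands for the number of blades minus 3. *)
  have {lt} lk : (k + 2 + 2 * r.+1 < l * r.+1)%N.
    by rewrite -(ltr_nat rat) !natrD !natrM; move: lt; rewrite mulrBl natrD; lra.
  pose p := (s.+1 * r.+2).-1.
  (* This is [n - d - 1 - p]; with [q = d + l], the condition [D + q <= r.+2 * q] becomes [lk]. *)
  pose D := (d * r.+1 + 2 * r + 5 + k)%N.
  have pE : p.+1 = (s.+1 * r.+2)%N by rewrite /p; lia.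
  have -> : (n + l = p.+1 + (D + (d + l)))%N by rewrite pE nE /D; nia.
  apply: (@real_configuration R p D (d + l) r s.+1) => //.
  - by rewrite /p; nia.
  - by lia.
  - by rewrite /D; nia.
move=> k n l nE kl.
have -> : (n + l = s.+1 + (2 * d + 3 + k + l))%N by lia.
(* Here [D = n - d - 1 - s] and [M = 2 * d + 3 + k + l], so [2 * D <= M] follows from
   [k + 3 < l]. *)
by apply: (@complex_configuration R s (d + 3 + k)); lia.
Qed.
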